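(* Let $n\ge 8$ and let $G$ be a $2$-connected graph of order $n$. If $\rho(G)\ge \rho(B_n)$, then $G$ contains a HIST unless $G\cong B_n$.
   Context: All graphs are finite, simple and undirected. The order of a graph is its number of vertices. A graph of order at least $3$ is $2$-connected if it is connected and has no cut vertex. $\rho(G)$ denotes the spectral radius of $G$, i.e. the largest eigenvalue of its adjacency matrix. A homeomorphically irreducible spanning tree (HIST) of a connected graph $G$ is a spanning tree $T$ of $G$ such that $T$ has no vertex of degree $2$ (degree taken in $T$). $K_m$ and $P_m$ denote the complete graph and the path on $m$ vertices. $B_n$ is the graph of order $n$ obtained from disjoint copies of $K_{n-3}$ and $P_3$ by choosing two distinct vertices $a,b$ of $K_{n-3}$ and adding two edges, one joining one end vertex of $P_3$ to $a$ and the other joining the other end vertex of $P_3$ to $b$. *)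

(* Defs.v *)
From mathcomp Require Import all_boot all_order all_algebra.
From mathcomp Require Import boolp classical_sets reals.
From mathcomp Require Import spectral complex polyrcf.

Set Implicit Arguments.
Unset Strict Implicit.
Unset Printing Implicit Defensive.

Import Order.TTheory GRing.Theory Num.Theory.

Record sgraph := SGraph {
  vertex :> finType;
  edge : rel vertex;
  edge_sym : symmetric edge;
  edge_irr : irreflexive edge
}.

Definition isomorphic (G H : sgraph) : Prop :=
  exists2 f : G -> H, bijective f & {mono f : x y / edge x y}.

Section SpectralRadius.
Local Open Scope ring_scope.
Variable R : realType.

Definition adjacency (G : sgraph) : 'M[R]_#|G| :=
  \matrix_(i, j) (edge (enum_val i) (enum_val j))%:R.

(* The adjacency matrix is real symmetric, so its (finitely many) eigenvalues
   in R are all its eigenvalues; [spectral_radiusP] shows that this supremum is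
   the largest of them. *)
Definition spectral_radius (G : sgraph) : R :=
  sup [set a | eigenvalue (adjacency G) a]%classic.

Lemma real_eigenvalue n (A : 'M[R]_n) :
  (0 < n)%N -> A^T = A -> exists a, eigenvalue A a.
Proof.
move=> n_gt0 symA; pose toC := real_complex R.
have [a] := eigenvalue_closed (map_mx toC A) n_gt0.
move=> eig_a; have /eigenvalueP[v vA v0] := eig_a.
have conjA : map_mx (@Num.conj R[i]) (map_mx toC A)^T = map_mx toC A.
  rewrite map_trmx symA; apply/matrixP=> i j; rewrite !mxE.
  by apply/CrealP; apply/complex_realP; exists (A i j).
pose w : 'cV_n := map_mx (@Num.conj R[i]) v^T.
have Aw : map_mx toC A *m w = a^* *: w.
  by rewrite -conjA /w -map_mxM -trmx_mul vA linearZ map_mxZ.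
have vw : (v *m w) 0 0 != 0.
  apply: contra v0 => /eqP vw0; apply/eqP/rowP => j.
  have /psumr_eq0P : \sum_j `|v 0 j| ^+ 2 = 0 :> R[i].
    rewrite -[RHS]vw0 mxE; apply: eq_bigr => k _.
    by rewrite !mxE normCK.
  move=> /(_ (fun _ _ => exprn_ge0 _ (normr_ge0 _)))/(_ j isT)/eqP.
  by rewrite expf_eq0 normr_eq0 mxE => /eqP.
have : a * (v *m w) 0 0 = a^* * (v *m w) 0 0.
  have := congr1 (fun M : 'M_1 => M 0 0) (mulmxA v (map_mx toC A) w).
  by rewrite Aw vA -scalemxAl -scalemxAr !mxE.
move=> /(mulIf vw) /esym/CrealP aR.
exists (complex.Re a).
move: eig_a; rewrite !eigenvalue_root_char -map_char_poly.
rewrite -[a in root _ a](RRe_real aR).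
by rewrite fmorph_root.
Qed.

Lemma spectral_radiusP (G : sgraph) : (0 < #|G|)%N ->
  eigenvalue (adjacency G) (spectral_radius G) /\
  (forall a, eigenvalue (adjacency G) a -> a <= spectral_radius G).
Proof.
move=> G_gt0; set A := adjacency G.
have symA : A^T = A by apply/matrixP=> i j; rewrite !mxE edge_sym.
have [a0 ea0] := real_eigenvalue G_gt0 symA.
have p0 : char_poly A != 0 by rewrite monic_neq0 ?char_poly_monic.
have mem_s a : eigenvalue A a = (a \in rootsR (char_poly A)).
  rewrite eigenvalue_root_char; have := roots_on_rootsR p0 a.
  by rewrite inE => <-.
pose m := \big[Num.max/a0]_(a <- rootsR (char_poly A)) a.
have le_m a : eigenvalue A a -> a <= m.
  by rewrite mem_s => sa; rewrite /m le_bigmax_seq.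
have em : eigenvalue A m.
  rewrite /m big_seq; elim/big_ind: _ => // [x y ex ey|a]; last by rewrite mem_s.
  by rewrite /Num.max; case: ifP.
suff -> : spectral_radius G = m by [].
apply/eqP; rewrite eq_le; apply/andP; split.
  by apply: ge_sup => //; exists m.
by apply: ub_le_sup => //; exists m.
Qed.

End SpectralRadius.

Section Connectivity.
Variable (V : finType).
Implicit Type e : rel V.

Definition connected_rel e : Prop := forall x y, connect e x y.

(* [ucycle e c]: the sequence [c] is closed and repetition-free. For symmetric
   [e] every edge gives such a sequence of size 2, so only larger ones are
   graph cycles. *)
Definition acyclic_rel e : Prop := forall c : seq V, ucycle e c -> size c <= 2.

Definition is_tree e : Prop :=
  [/\ 0 < #|V|, symmetric e, irreflexive e, connected_rel e & acyclic_rel e].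

Definition degree e (x : V) : nat := #|[pred y | e x y]|.

End Connectivity.

Section DeleteVertex.
Variables (G : sgraph) (v : G).

Definition del_edge : rel {x : G | x != v} :=
  fun x y => edge (val x) (val y).

Fact del_edge_sym : symmetric del_edge.
Proof. by move=> x y; exact: edge_sym. Qed.

Fact del_edge_irr : irreflexive del_edge.
Proof. by move=> x; exact: edge_irr. Qed.

Definition del_vertex : sgraph := SGraph del_edge_sym del_edge_irr.

End DeleteVertex.

Definition connected_graph (G : sgraph) : Prop := connected_rel (@edge G).

Definition num_components (G : sgraph) : nat := n_comp (@edge G) G.

Definition cut_vertex (G : sgraph) (v : G) : Prop :=
  num_components G < num_components (del_vertex v).

Definition two_connected (G : sgraph) : Prop :=
  [/\ 3 <= #|G|, connected_graph G & forall v : G, ~ cut_vertex v].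

(* A spanning subgraph of [G] has the vertex set of [G], hence is given by an
   edge relation [t] contained in that of [G]. *)
Definition spanning_tree (G : sgraph) (t : rel G) : Prop :=
  subrel t (@edge G) /\ is_tree t.

Definition has_HIST (G : sgraph) : Prop :=
  exists2 t : rel G, spanning_tree t & forall x, degree t x != 2.

Section Complete.
Variable m : nat.
Definition complete_edge : rel 'I_m := fun i j => i != j.
Fact complete_edge_sym : symmetric complete_edge.
Proof. by move=> i j; rewrite /complete_edge /= eq_sym. Qed.
Fact complete_edge_irr : irreflexive complete_edge.
Proof. by move=> i; rewrite /complete_edge /= eqxx. Qed.
Definition complete_graph : sgraph :=
  SGraph complete_edge_sym complete_edge_irr.
End Complete.

Section Path.
Variable m : nat.
Definition path_edge : rel 'I_m :=
  fun i j => (i.+1 == j :> nat) || (j.+1 == i :> nat).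
Fact path_edge_sym : symmetric path_edge.
Proof. by move=> i j; rewrite /path_edge /= orbC. Qed.
Fact path_edge_irr : irreflexive path_edge.
Proof. by move=> i; rewrite /path_edge /= orbb eqn_leq ltnn. Qed.
Definition path_graph : sgraph := SGraph path_edge_sym path_edge_irr.
End Path.

(* The two vertices a, b of K_(n-3) are those numbered 0 and 1 (the choice is
   immaterial up to isomorphism); the end vertices of P_3 are 0 and 2. This is
   the intended graph for n >= 5, when K_(n-3) has two vertices. *)
Section B.
Variable n : nat.

Definition B_link (i : complete_graph (n - 3)) (p : path_graph 3) : bool :=
  ((i == 0 :> nat) && (p == 0 :> nat)) || ((i == 1 :> nat) && (p == 2 :> nat)).

Definition B_edge : rel (complete_graph (n - 3) + path_graph 3)%type :=
  fun x y => match x, y with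
  | inl i, inl j => edge i j
  | inr p, inr q => edge p q
  | inl i, inr p | inr p, inl i => B_link i p
  end.

Fact B_edge_sym : symmetric B_edge.
Proof. by case=> i [] j //; exact: edge_sym. Qed.

Fact B_edge_irr : irreflexive B_edge.
Proof. by case=> i; exact: edge_irr. Qed.

Definition B_graph : sgraph := SGraph B_edge_sym B_edge_irr.
End B.

(* Main.v *)
(* Weighting the vertices shows that rho(G) <= n - 4 if there is a positive
   weight f with A f <= (n - 4) f, whereas rho(B_n) > n - 4 since B_n properly
   contains K_(n-3). The constant weight gives a vertex u of degree at least
   n - 3. Its spanning star is a HIST when u is adjacent to all other vertices.
   Otherwise one tries to hang the at most two non-neighbours of u two levels
   below it, moving few other vertices so that every vertex used as a parent
   gets exactly two children. If all these attempts fail, G is so constrained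
   that either a weight with two values differing by one (such as 3 and 4) gives
   rho(G) <= n - 4, or G is a spanning subgraph of B_n. In the latter case, A x
   <= rho x for the positive eigenvector x of B_n, and rho(G) >= rho(B_n) forces
   equality, hence G = B_n. *)
Require Import Defs.
From mathcomp Require Import all_boot all_order all_algebra.
From mathcomp Require boolp.
From mathcomp Require Import reals.
From mathcomp Require Import ring lra zify.

Import Order.TTheory GRing.Theory Num.Theory.

(** * Bounds on the spectral radius from positive weights *)

Section Spectral.
Local Open Scope ring_scope.
Context {R : realType} {G : sgraph}.
Implicit Types (x : G -> R) (a : R).

Lemma adjacency_eigenvalueP a :
  reflect (exists2 x, (exists v : G, x v != 0) &
             forall v : G, \sum_(w | edge v w) x w = a * x v)
          (eigenvalue (adjacency R G) a).
Proof.
have sumE (r : 'rV[R]_#|G|) v : (r *m adjacency R G) 0 (enum_rank v) =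
    \sum_(w | edge v w) r 0 (enum_rank w).
  rewrite mxE (reindex _ (onW_bij _ (@enum_val_bij G))) /=.
  rewrite [RHS]big_mkcond /=; apply: eq_bigr => i _.
  rewrite mxE enum_rankK enum_valK edge_sym.
  by case: ifP => _; rewrite ?mulr1 ?mulr0.
apply: (iffP eigenvalueP) => [[r rA r0]|[x [v xv0] xA]].
  exists (fun v => r 0 (enum_rank v)).
    have /rV0Pn[i ri] := r0.
    by exists (enum_val i); rewrite enum_valK.
  by move=> v; rewrite -sumE rA mxE.
exists (\row_i x (enum_val i)); last first.
  by apply/rV0Pn; exists (enum_rank v); rewrite mxE enum_rankK.
apply/rowP => i; rewrite -[i]enum_valK sumE !mxE !enum_valK -xA.
by apply: eq_bigr => w _; rewrite mxE enum_rankK.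
Qed.

Lemma ler_spectral_radius a x : (exists v : G, x v != 0) ->
  (forall v : G, \sum_(w | edge v w) x w = a * x v) -> a <= spectral_radius R G.
Proof.
move=> [v xv] xA.
have G0 : (0 < #|G|)%N by apply/card_gt0P; exists v.
have [_ ->] // := spectral_radiusP R G0.
by apply/adjacency_eigenvalueP; exists x => //; exists v.
Qed.

Hypothesis connG : connected_graph G.

(* Pairing [x] with the absolute value of an eigenvector for the spectral
   radius, which is positive by connectivity. *)
Lemma subharmonic_eq a x : (forall v : G, 0 < x v) ->
  (forall v : G, \sum_(w | edge v w) x w <= a * x v) ->
  a <= spectral_radius R G ->
  forall v : G, \sum_(w | edge v w) x w = a * x v.
Proof.
move=> x0 xA; case: (posnP #|G|) => [G0|G0] ale.
  by move=> v; have := card0_eq G0 v; rewrite !inE.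
have [/adjacency_eigenvalueP[z [v0 zv0] zA] _] := spectral_radiusP R G0.
move: (spectral_radius R G) ale zA => b leab zA.
pose y v := `|z v|.
have y_ge0 v : 0 <= y v by exact: normr_ge0.
have yA v : b * y v <= \sum_(w | edge v w) y w.
  apply: le_trans (ler_norm_sum _ _ _).
  by rewrite zA normrM ler_wpM2r ?normr_ge0 ?ler_norm.
have dual : \sum_v y v * (\sum_(w | edge v w) x w) =
            \sum_v x v * (\sum_(w | edge v w) y w).
  under eq_bigr => v _ do rewrite big_distrr /= big_mkcond /=.
  rewrite exchange_big /=; apply: eq_bigr => v _.
  rewrite big_distrr /= [RHS]big_mkcond /=; apply: eq_bigr => w _.
  by rewrite edge_sym mulrC.
(* By [dual], the nonnegative terms [f v + g v + h v] sum to zero over all [v], so each of them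
   vanishes. *)
pose f v := y v * (a * x v - \sum_(w | edge v w) x w).
pose g v := x v * ((\sum_(w | edge v w) y w) - b * y v).
pose h v := (b - a) * (x v * y v).
have f0 v : 0 <= f v by rewrite mulr_ge0 ?subr_ge0.
have g0 v : 0 <= g v by rewrite mulr_ge0 ?subr_ge0 // ltW.
have h0 v : 0 <= h v by rewrite !mulr_ge0 ?subr_ge0 // ltW.
have : \sum_v (f v + g v + h v) = 0.
  have E v : f v + g v + h v = x v * (\sum_(w | edge v w) y w) -
                               y v * (\sum_(w | edge v w) x w).
    by rewrite /f /g /h; ring.
  by under eq_bigr do rewrite E; rewrite sumrB dual subrr.
move=> /psumr_eq0P => /(_ (fun v _ => addr_ge0 (addr_ge0 (f0 v) (g0 v)) (h0 v))).
move=> fgh0.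
have fgh v : f v = 0 /\ g v = 0.
  have := fgh0 v isT; have := f0 v; have := g0 v; have := h0 v.
  by move=> *; split; lra.
(* Since [g v] vanishes, a zero of [y] spreads to all neighbours; by connectivity it would reach
   [v0], where [z] is nonzero. *)
have y_step v w : edge v w -> y v = 0 -> y w = 0.
  move=> vw yv0; have [_ /eqP] := fgh v.
  rewrite mulf_eq0 gt_eqF //= yv0 mulr0 subr0 => /eqP/psumr_eq0P yy.
  exact: yy.
have y_gt0 v : y v != 0.
  apply: contra zv0 => /eqP yv; rewrite -normr_eq0; apply/eqP.
  have /connectP[p] := connG v v0; elim: p v yv => [|w p IHp] v yv /=.
    by move=> _ ->.
  by move=> /andP[vw pw]; apply: IHp pw; exact: y_step vw yv.
move=> v; have [/eqP] := fgh v.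
rewrite mulf_eq0 (negPf (y_gt0 v)) /= subr_eq0 => /eqP ->//.
Qed.

(** If the spectral radius exceeded [a], the inequality with it in place of [a] would be strict at
    every vertex, against [subharmonic_eq]. *)
Lemma spectral_radius_le a x : (0 < #|G|)%N -> (forall v : G, 0 < x v) ->
  (forall v : G, \sum_(w | edge v w) x w <= a * x v) -> spectral_radius R G <= a.
Proof.
move=> /card_gt0P[v _] x0 xA; rewrite leNgt; apply/negP => lta.
have xA' w : \sum_(w' | edge w w') x w' < spectral_radius R G * x w.
  by apply: le_lt_trans (xA w) _; rewrite ltr_pM2r.
have := subharmonic_eq _ x x0 (fun w => ltW (xA' w)) (lexx _) v.
by apply/eqP; rewrite lt_eqF.
Qed.

(** The weight is [k + 1] on [l] and [k] elsewhere; this form leaves only natural-number arithmetic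
    to check. *)
Lemma spectral_radius_weight (l : seq G) k m : (0 < #|G|)%N -> (0 < k)%N ->
  (forall v : G, k * degree (@edge G) v + count (edge v) l <=
                 m * (k + (v \in l)))%N ->
  spectral_radius R G <= m%:R.
Proof.
move=> G0 k0 kl; apply: (spectral_radius_le _ (fun v => (k + (v \in l))%:R)) => //.
  by move=> v; rewrite ltr0n addn_gt0 k0.
move=> v; rewrite -natrM -natr_sum ler_nat; apply: leq_trans (kl v).
rewrite big_split /= sum_nat_const mulnC leq_add2l -big_mkcondr /= sum1_card.
rewrite -size_filter; apply: leq_trans (card_size _).
by apply/subset_leq_card/subsetP => w; rewrite mem_filter unfold_in.
Qed.

End Spectral.

(** * A positive eigenvector of [B_graph n] *)

Section BEigenvector.
Local Open Scope ring_scope.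
Context {R : realType}.

(* For a symmetric vector on [B_n] with value [2] at the middle of the path and
   [a] at its ends, the eigenvalue equations at the path force [a ^ 2 - 2] on
   the two attachment vertices; [t] is the value on the rest of the clique. *)
Let profile n (a t : R) (v : B_graph n) : R :=
  match v with
  | inl i => if (i < 2)%N then a ^+ 2 - 2 else t
  | inr p => if p == 1 :> nat then 2 else a
  end.

(** The equations on the clique determine [t] and leave one quartic equation for [a], which has a
    root between [n - 4] and [n - 3]. *)
Lemma B_graph_eigenvector (n : nat) : (8 <= n)%N ->
  exists2 a : R, (n - 4)%:R < a & exists2 x : B_graph n -> R,
    forall v, 0 < x v & forall v, \sum_(w | edge v w) x w = a * x v.
Proof.
case: n => [|[|[|[|[|k]]]]] // k3; have {}k3 : (3 <= k)%N by [].
have -> : (k.+4.+1 - 4 = k.+1)%N by lia.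
have K3 : 3 <= k%:R :> R by rewrite ler_nat.
pose K : R := k%:R; rewrite -/K in K3.
(* The equation at an attachment vertex after eliminating [t] and clearing the denominator; [K]
   counts the clique vertices not attached to the path. *)
pose q : {poly R} := (('X - 1) * ('X ^+ 2 - 2%:P) - 'X) * ('X - (K - 1)%:P)
                     - (2 * K)%:P * ('X ^+ 2 - 2%:P).
have qE a : q.[a] = ((a - 1) * (a ^+ 2 - 2) - a) * (a - (K - 1)) -
                     (2 * K) * (a ^+ 2 - 2).
  by rewrite /q !hornerE.
have [||a] := @poly_ivt R q (K + 1) (K + 2); first by lra.
  by rewrite !qE; apply/andP; split; nra.
move=> /andP[Ka aK2] /rootP qa.
(* The value of [q] at [K + 1] is [-2 (K + 1)], so the root is not there. *)
have aK : K + 1 < a.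
  rewrite lt_neqAle Ka andbT; apply/eqP => aE.
  by move: qa; rewrite qE -aE; nra.
have d0 : a - (K - 1) != 0 by apply/eqP; lra.
have s0 : 0 < a ^+ 2 - 2 by nra.
(* The equation at an unattached clique vertex, solved for [t]. *)
pose t := 2 * (a ^+ 2 - 2) / (a - (K - 1)).
have t0 : 0 < t by rewrite /t divr_gt0 ?mulr_gt0 //; lra.
exists a; first by rewrite -natr1.
exists (profile _ a t); first by case=> [i|p] /=; case: ifP => _; lra.
have td : t * (a - (K - 1)) = 2 * (a ^+ 2 - 2) by rewrite /t divfK.
have at_end : (a ^+ 2 - 2) + K * t + a = a * (a ^+ 2 - 2).
  apply: (mulIf d0); move: qa; rewrite qE => qa.
  have -> : (a ^+ 2 - 2 + K * t + a) * (a - (K - 1)) =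
     (a ^+ 2 - 2 + a) * (a - (K - 1)) + K * (t * (a - (K - 1))) by ring.
  by rewrite td; lra.
have sumK (F : 'I_k.+2 -> R) :
  (forall i : 'I_k.+2, (1 < i)%N -> F i = t) ->
  \sum_i F i = F ord0 + F (lift ord0 ord0) + K * t.
  move=> Ft; rewrite 2!big_ord_recl addrA; congr (_ + _).
  rewrite (eq_bigr (fun=> t)) => [|i _]; last by rewrite Ft.
  by rewrite sumr_const card_ord mulr_natl.
have sumB v : \sum_(w | edge v w) profile k.+4.+1 a t w =
    \sum_(i < k.+2 | @B_edge k.+4.+1 v (inl i)) profile k.+4.+1 a t (inl i) +
    \sum_(p < 3 | @B_edge k.+4.+1 v (inr p)) profile k.+4.+1 a t (inr p).
  exact: big_sumType.
case=> [i|p]; rewrite sumB; last first.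
  rewrite !(big_mkcond (fun _ => B_edge _ _)) /= !big_ord_recl big_ord0.
  rewrite big1 => [|j _]; last by [].
  by case: p => [[|[|[|p]]]] //= _; rewrite /B_link /edge /= /path_edge /=; ring.
have P : \sum_(p < 3 | @B_edge k.+4.+1 (inl i) (inr p)) profile k.+4.+1 a t (inr p) =
         if (i < 2)%N then a else 0.
  rewrite big_mkcond /= !big_ord_recl big_ord0 /= /B_link /=.
  by case: i => [[|[|i]] ?] /=; rewrite ?addr0 ?add0r.
rewrite P.
have Q : \sum_(j < k.+2 | @B_edge k.+4.+1 (inl i) (inl j)) profile k.+4.+1 a t (inl j) =
         a ^+ 2 - 2 + (a ^+ 2 - 2) + K * t - profile k.+4.+1 a t (inl i).
  rewrite -(sumK (fun j => profile k.+4.+1 a t (inl j))); last first.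
    by move=> j /= j1; rewrite ltnNge j1.
  rewrite [in RHS](bigD1 i) //= addrC addrK; apply: eq_bigl => j.
  by rewrite eq_sym.
rewrite Q /=; case: ifP => _; first by lra.
by lra.
Qed.

End BEigenvector.

(** * Trees given by a parent map, and HISTs obtained from a star *)

Section ParentTree.
Context {V : finType}.
Variables (r : V) (p : V -> V).

Definition parent_rel : rel V :=
  fun x y => (x != r) && (p x == y) || (y != r) && (p y == x).

Variable d : V -> nat.
Hypothesis d_parent : forall x, x != r -> d (p x) < d x.

Lemma parent_rel_sym : symmetric parent_rel.
Proof. by move=> x y; rewrite /parent_rel orbC. Qed.

Lemma parent_relP {x y} : parent_rel x y -> d y <= d x -> x != r /\ p x = y.
Proof.
case/orP=> /andP[xr /eqP pxy] // le_yx.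
by have := d_parent _ xr; rewrite pxy ltnNge le_yx.
Qed.

Lemma parent_rel_tree : is_tree parent_rel.
Proof.
split; first by apply/card_gt0P; exists r.
- exact: parent_rel_sym.
- move=> x; rewrite /parent_rel orbb; apply/negP => /andP[/d_parent + /eqP pxx].
  by rewrite pxx ltnn.
- suff to_r x : connect parent_rel x r.
    move=> x y; apply: connect_trans (to_r x) _.
    by rewrite (sym_connect_sym parent_rel_sym).
  have [k] := ubnP (d x); elim: k x => // k IHk x; rewrite ltnS => dxk.
  have [->|xr] := eqVneq x r; first exact: connect0.
  apply: connect_trans (IHk (p x) (leq_trans (d_parent _ xr) dxk)).
  by apply: connect1; rewrite /parent_rel xr eqxx.
move=> c /andP[cyc uc]; rewrite leqNgt; apply/negP => c3.
(* both neighbours on the cycle of a vertex of maximal depth are its parent *)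
have [x0 x0c] : exists x, x \in c.
  by case: c c3 {cyc uc} => // x c _; exists x; exact: mem_head.
have [x xc x_max] := @arg_maxnP _ x0 (mem c) d x0c.
have [i s cE] := rot_to xc.
have s_max y : y \in s -> d y <= d x.
  move=> ys; have yc : y \in c by rewrite -(mem_rot i) cE inE ys orbT.
  exact: x_max.
move: cyc uc c3; rewrite -(rot_cycle i) -(rot_uniq i) -(size_rot i) cE.
case: s s_max {cE} => [|y [|z s]] // s_max; rewrite /cycle rcons_path.
move=> /andP[/andP[xy _]]; rewrite parent_rel_sym => xl uc _.
have [_ py] := parent_relP xy (s_max _ (mem_head _ _)).
have [_] := parent_relP xl (s_max _ (mem_last _ _)); rewrite py /= => yl.
by move: uc; rewrite /= yl mem_last andbF.
Qed.

(** By depth, the parent of [x] is not also one of its children, so the two contributions add up. *)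
Lemma degree_parent_rel x :
  degree parent_rel x = (x != r) + #|[set y | (y != r) && (p y == x)]|.
Proof.
have [xr|xr] := eqVneq x r; rewrite /degree /parent_rel.
  by rewrite add0n; apply: eq_card => y; rewrite !inE xr eqxx.
set S := [set y | _].
have /negPf pxS : p x \notin S.
  rewrite inE; apply/negP => /andP[/d_parent + /eqP ppx].
  by rewrite ppx ltnNge ltnW // d_parent.
transitivity #|p x |: S|; last by rewrite cardsU1 pxS.
by apply: eq_card => y; rewrite !inE xr /= eq_sym.
Qed.

End ParentTree.

(* All vertices hang under [r], except those of [A], moved under [a], and those
   of [A'], moved under [a']; the vertex [a'] may itself belong to [A]. *)
Lemma HIST_two_moves (G : sgraph) (r a a' : G) (A A' : {set G}) :
  [disjoint A & A'] -> #|A| != 1 -> #|A'| != 1 -> #|A| + #|A'| + 4 <= #|G| ->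
  r \notin A -> r \notin A' -> a \notin r |: A :|: A' -> a' \notin a |: (r |: A') ->
  {in A, forall x, edge a x} -> {in A', forall x, edge a' x} ->
  (forall x, x \notin r |: A :|: A' -> edge r x) ->
  has_HIST G.
Proof.
move=> disAA' A1 A'1 cardAA' rA rA' aN a'N eA eA' er.
pose p x := if x \in A then a else if x \in A' then a' else r.
(* [A'] lies deeper than [A] because its parent [a'] may be in [A]. *)
pose d x := if x == r then 0 else if x \in A' then 3 else if x \in A then 2 else 1.
move: aN a'N; rewrite !inE !negb_or => /andP[/andP[ar aA] aA'] /and3P[a'a a'r a'A'].
have d_parent x : x != r -> d (p x) < d x.
  rewrite /d /p => /negPf xr; rewrite xr.
  have [xA|xA] := boolP (x \in A).
    by rewrite (disjointFr disAA' xA) (negPf ar) (negPf aA) (negPf aA').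
  have [xA'|xA'] := boolP (x \in A'); last by rewrite eqxx.
  by rewrite (negPf a'r) (negPf a'A'); case: ifP.
exists (parent_rel r p).
  split; last exact: (parent_rel_tree _ _ d).
  have ep x : x != r -> edge x (p x).
    move=> xr; rewrite edge_sym /p.
    have [xA|xA] := boolP (x \in A); first exact: eA.
    have [xA'|xA'] := boolP (x \in A'); first exact: eA'.
    by apply: er; rewrite !inE (negPf xr) (negPf xA).
  by move=> x y /orP[] /andP[xr /eqP <-]; [exact: ep|rewrite edge_sym; exact: ep].
(* A vertex other than [r] has degree two only if it has exactly one child, but it has [#|A|],
   [#|A'|] or no children. The root keeps at least three children by the bound on [#|G|]. *)
move=> x; rewrite (degree_parent_rel _ _ d d_parent).
have [->|xr] := eqVneq x r.
  have -> : [set y | (y != r) && (p y == r)] = ~: (r |: A :|: A').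
    apply/setP => y; rewrite !inE /p -orbA negb_or.
    case: (y \in A); rewrite ?(negPf ar) //.
    by case: (y \in A'); rewrite ?(negPf a'r) ?eqxx ?andbT.
  rewrite add0n; apply/eqP => c2.
  have := cardsC (r |: A :|: A'); rewrite c2.
  have : #|r |: A :|: A'| <= #|r |: A| + #|A'| by rewrite cardsU leq_subr.
  rewrite cardsU1 rA.
  by move: cardAA'; lia.
rewrite eqSS.
have [->|xa] := eqVneq x a.
  have -> : [set y | (y != r) && (p y == a)] = A; last by [].
  apply/setP => y; rewrite !inE /p; have [->|_] := eqVneq y r; first by rewrite (negPf rA).
  case: (y \in A); rewrite ?eqxx //.
  by case: (y \in A'); rewrite ?(negPf a'a) ?[r == a]eq_sym ?(negPf ar).
have [->|xa'] := eqVneq x a'.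
  have -> : [set y | (y != r) && (p y == a')] = A'; last by [].
  apply/setP => y; rewrite !inE /p; have [->|_] := eqVneq y r; first by rewrite (negPf rA').
  have [yA|_] := boolP (y \in A).
    by rewrite (disjointFr disAA' yA) eq_sym (negPf a'a).
  by case: (y \in A'); rewrite ?eqxx // eq_sym (negPf a'r).
suff -> : [set y | (y != r) && (p y == x)] = set0 by rewrite cards0.
apply/setP => y; rewrite !inE /p.
case: ifP => _; first by rewrite [_ == x]eq_sym (negPf xa) andbF.
case: ifP => _; first by rewrite [_ == x]eq_sym (negPf xa') andbF.
by rewrite [_ == x]eq_sym (negPf xr) andbF.
Qed.

(** * Edges leaving a vertex set in a 2-connected graph *)

(** A path from [x] to [z] that avoids [c] has to leave [X] along some edge. *)
Lemma two_connected_crossing (G : sgraph) (c : G) (X : {set G}) (x z : G) :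
  two_connected G -> c \notin X -> x \in X -> z \notin X -> z != c ->
  exists y w, [/\ y \in X, w \notin X, w != c & edge y w].
Proof.
move=> [_ connG noCut] cX xX zX zc.
have xc : x != c by apply: contraNneq cX => <-.
have symD := sym_connect_sym (@del_edge_sym G c).
pose x' : del_vertex c := Sub x xc; pose z' : del_vertex c := Sub z zc.
have xz' : connect (@del_edge G c) x' z'.
  rewrite -(root_connect symD).
  (* [G] has a single component, so a second one after deleting [c] would make [c] a cut vertex. *)
  have : num_components (del_vertex c) <= 1.
    rewrite leqNgt; apply/negP => D; apply: (noCut c); apply: leq_trans D.
    rewrite ltnS /num_components -(n_comp_connect (sym_connect_sym (@edge_sym G)) x).
    by apply/subset_leq_card/subsetP => y; rewrite !inE => /andP[-> _]; exact: connG.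
  have rt y : fingraph.root (@del_edge G c) y \in [predI roots (@del_edge G c) & del_vertex c].
    by rewrite !inE roots_root.
  rewrite leqNgt; apply: contraNT => N; apply/card_gt1P.
  by exists (fingraph.root (@del_edge G c) x'), (fingraph.root (@del_edge G c) z').
have [[/existsP[y /existsP[w /and4P[]]]]|N] :=
    boolP [exists y, exists w, [&& y \in X, w \notin X, w != c & edge y w]].
  by exists y, w.
case/connectP: xz' => s; have : val x' \in X by [].
elim: s (x') => [|y s IHs] v vX /=.
  by move=> _ zE; move: zX; rewrite -[z]/(val z') zE vX.
move=> /andP[vy ys]; apply: IHs ys; apply: contraNT N => yX.
by apply/existsP; exists (val v); apply/existsP; exists (val y); apply/and4P; split => //; exact: valP y.
Qed.

(** * Comparison of a graph with [B_graph n] *)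

Lemma card_B_graph n : 3 <= n -> #|B_graph n| = n.
Proof. by move=> n3; rewrite card_sum !card_ord subnK. Qed.

Lemma B_graph_spectral_radius_gt (R : realType) n : 8 <= n ->
  ((n - 4)%:R < spectral_radius R (B_graph n))%R.
Proof.
move=> n8; have [a an [x x0 xB]] := @B_graph_eigenvector R n n8.
apply: lt_le_trans an _; apply: ler_spectral_radius xB.
have /card_gt0P[v _] : 0 < #|B_graph n| by rewrite card_B_graph; lia.
by exists v; rewrite gt_eqF.
Qed.

(** Pulled back along [f], the eigenvector of [B_graph n] satisfies the inequality of
    [subharmonic_eq], hence equality. An edge missing from [G] would make it strict at an end of
    that edge. *)
Lemma isomorphic_B_graph (R : realType) n (G : sgraph) (f : G -> B_graph n) :
  8 <= n -> #|G| = n -> connected_graph G ->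
  (spectral_radius R (B_graph n) <= spectral_radius R G)%R ->
  injective f -> {homo f : x y / edge x y} -> isomorphic G (B_graph n).
Proof.
move=> n8 Gn connG rho_le f_inj f_edge.
have f_bij : bijective f.
  by apply: (inj_card_bij f_inj); rewrite card_B_graph ?Gn //; lia.
exists f => // v w; apply/idP/idP => [fvw|]; last exact: f_edge.
have [a an [x x0 xB]] := @B_graph_eigenvector R n n8.
have a_le : (a <= spectral_radius R G)%R.
  apply: le_trans rho_le; apply: ler_spectral_radius xB.
  by exists (f v); rewrite gt_eqF.
have xBf u : (\sum_(u' | edge (f u) (f u')) x (f u') = a * x (f u))%R.
  by rewrite -xB [RHS](reindex f) //; exact: onW_bij.
have le_xf u : (\sum_(u' | edge u u') x (f u') <=
                \sum_(u' | edge (f u) (f u')) x (f u'))%R.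
  rewrite big_mkcond [leRHS]big_mkcond; apply: ler_sum => u' _.
  by case: ifP => [/f_edge ->|_] //; case: ifP => // _; exact: ltW.
have xf := subharmonic_eq connG a (fun u => x (f u)) (fun u => x0 (f u)).
have {}xf u : (\sum_(u' | edge u u') x (f u') = a * x (f u))%R.
  by apply: xf => // u'; rewrite -xBf.
apply/negPn/negP => Nvw; have := xBf v; rewrite (bigD1 w) // => /eqP.
apply/negP; rewrite gt_eqF // -xf ltr_pwDl //.
rewrite big_mkcond [leRHS]big_mkcond; apply: ler_sum => u' _.
case: ifP => [vu'|_]; last by case: ifP => // _; exact: ltW.
have -> : u' != w by apply: contraNneq Nvw => <-.
by rewrite f_edge // andbT.
Qed.

Lemma B_graph_embedding (G : sgraph) (u z y w1 w2 : G) :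
  uniq [:: u; z; y; w1; w2] ->
  (forall x, edge y x -> x \in [:: u; w1]) ->
  (forall x, edge w1 x -> x \in [:: y; w2]) ->
  (forall x, edge w2 x -> x \in [:: w1; z]) ->
  exists2 f : G -> B_graph #|G|, injective f & {homo f : x x' / edge x x'}.
Proof.
move=> uniq5 Ny Nw1 Nw2.
(* [u] and [z] come first, to receive the numbers 0 and 1 of the attachment vertices. *)
pose s := u :: z :: enum [predC [:: u; z; y; w1; w2]].
have sz_s : size s = #|G| - 3.
  rewrite -(cardC (mem [:: u; z; y; w1; w2])) (card_uniqP uniq5) /=.
  by rewrite -cardE.
have s_gt0 : 0 < #|G| - 3 by rewrite -sz_s.
have mem_s x : x \notin [:: y; w1; w2] -> x \in s.
  rewrite !inE mem_enum !inE; case: (x == u) (x == z) => [] [] //=.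
(* The default value is harmless: [f] applies [idx] only to members of [s]. *)
pose idx x : complete_graph (#|G| - 3) := insubd (Ordinal s_gt0) (index x s).
have idxE x : x \in s -> idx x = index x s :> nat.
  move=> xs; rewrite val_insubd.
  by have -> : index x s < #|G| - 3 by rewrite -sz_s index_mem.
pose f x : B_graph #|G| :=
  if x == y then inr ord0 else if x == w1 then inr (inord 1)
  else if x == w2 then inr ord_max else inl (idx x).
have := uniq5; rewrite /= !inE !negb_or -!andbA.
case/and5P=> uz uy uw1 uw2 /and5P[zy zw1 zw2 yw1 /and3P[yw2 w12 _]].
have fy : f y = inr ord0 by rewrite /f eqxx.
have fw1 : f w1 = inr (inord 1) by rewrite /f eq_sym (negPf yw1) eqxx.
have fw2 : f w2 = inr ord_max.
  by rewrite /f !(eq_sym w2) (negPf yw2) (negPf w12) eqxx.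
have fK x : x \notin [:: y; w1; w2] -> f x = inl (idx x).
  by rewrite !inE !negb_or /f => /and3P[/negPf-> /negPf-> /negPf->].
have uK : u \notin [:: y; w1; w2] by rewrite !inE !negb_or uy uw1.
have zK : z \notin [:: y; w1; w2] by rewrite !inE !negb_or zy zw1.
have idx_u : idx u = 0 :> nat by rewrite idxE ?mem_s //= eqxx.
have idx_z : idx z = 1 :> nat by rewrite idxE ?mem_s //= (negPf uz) eqxx.
have memP x : [\/ x = y, x = w1, x = w2 | x \notin [:: y; w1; w2]].
  rewrite !inE; have [->|_] := eqVneq x y; first by constructor 1.
  have [->|_] := eqVneq x w1; first by constructor 2.
  by have [->|_] := eqVneq x w2; [constructor 3|constructor 4].
have f_inj : injective f.
  move=> x x'.
  case: (memP x) => [->|->|->|xK]; case: (memP x') => [->|->|->|x'K] //;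
    rewrite ?fy ?fw1 ?fw2 ?fK // => -[] //;
    try by move=> /(congr1 val) /=; rewrite ?inordK.
  move=> /(congr1 val) /= ; rewrite !idxE ?mem_s // => idxx'.
  exact: (index_inj x (mem_s _ xK) (mem_s _ x'K) idxx').
have homP v v' : v \in [:: y; w1; w2] -> edge v v' -> edge (f v) (f v').
  rewrite !inE => /or3P[] /eqP->; rewrite ?fy ?fw1 ?fw2.
  - move=> /Ny; rewrite !inE => /orP[] /eqP->; rewrite ?fw1 ?fK //=.
      by rewrite /B_link idx_u.
    by rewrite /edge /= /path_edge inordK.
  - move=> /Nw1; rewrite !inE => /orP[] /eqP->; rewrite ?fy ?fw2 /= /edge /=;
      by rewrite /path_edge inordK.
  - move=> /Nw2; rewrite !inE => /orP[] /eqP->; rewrite ?fw1 ?fK //=.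
      by rewrite /edge /= /path_edge inordK.
    by rewrite /B_link idx_z orbT.
suff f_hom x x' : edge x x' -> edge (f x) (f x') by exists f.
have [xP|xK] := boolP (x \in [:: y; w1; w2]); first exact: homP.
have [x'P|x'K] := boolP (x' \in [:: y; w1; w2]).
  by move=> xx'; rewrite edge_sym; apply: homP => //; rewrite edge_sym.
(* Both images lie in the clique, where being distinct is being adjacent. *)
move=> xx'; rewrite !fK //; apply/eqP => idxx'.
have := f_inj x x'; rewrite !fK // idxx' => /(_ erefl) E.
by move: xx'; rewrite E edge_irr.
Qed.

(** * Degree counts, and stars with two or four moved vertices *)

Section Degrees.
Context {G : sgraph}.
Implicit Types (v : G) (s : seq G).

Lemma edge_neq {v w : G} : edge v w -> v != w.
Proof. by apply: contraTneq => ->; rewrite edge_irr. Qed.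

Lemma degree_le_size s v :
  (forall w, edge v w -> w \in s) -> degree (@edge G) v <= size s.
Proof.
move=> vs; apply: leq_trans (card_size s).
by apply/subset_leq_card/subsetP => w; exact: vs.
Qed.

Lemma degree_add_size_le s v : uniq s -> all (predC (edge v)) s ->
  degree (@edge G) v + size s <= #|G|.
Proof.
move=> us /allP vs; rewrite -(cardC [pred w | edge v w]) leq_add2l.
rewrite -(card_uniqP us).
by apply/subset_leq_card/subsetP => w /vs; rewrite !inE.
Qed.

(** The second move is empty, with [b] as a dummy parent. *)
Lemma HIST_move2 (r a b c : G) : 6 <= #|G| -> uniq [:: r; a; b; c] ->
  edge a b -> edge a c -> (forall x, x \notin [:: r; b; c] -> edge r x) ->
  has_HIST G.
Proof.
move=> n6; rewrite /= !inE !negb_or -!andbA.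
case/and4P=> ra rb rc /and4P[ab ac bc _] eab eac er.
apply: (@HIST_two_moves G r a b [set b; c] set0).
- by rewrite -setI_eq0 setI0.
- by rewrite cards2 bc.
- by rewrite cards0.
- by rewrite cards2 cards0 bc addn0.
- by rewrite !inE negb_or rb.
- by rewrite inE.
- by rewrite !inE !negb_or eq_sym ra ab ac.
- by rewrite !inE !negb_or ![b == _]eq_sym ab rb.
- by move=> x; rewrite !inE => /orP[] /eqP ->.
- by move=> x; rewrite inE.
- by move=> x; rewrite !inE orbF => xN; apply: er; rewrite !inE.
Qed.

(** Here [a'] may be [b] or [c], which gives a tree of depth three. *)
Lemma HIST_move4 (r a b c a' b' c' : G) : 8 <= #|G| ->
  uniq [:: r; a; b; c; b'; c'] -> a' \notin [:: r; a; b'; c'] ->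
  edge a b -> edge a c -> edge a' b' -> edge a' c' ->
  (forall x, x \notin [:: r; b; c; b'; c'] -> edge r x) -> has_HIST G.
Proof.
move=> n8; rewrite /= !inE !negb_or -!andbA.
case/and5P=> ra rb rc rb' /and5P[rc' ab ac ab' /and5P[ac' bc bb' bc' /and4P[cb' cc' b'c' _]]].
case/and4P=> a'r a'a a'b' a'c' eab eac eab' eac' er.
apply: (@HIST_two_moves G r a a' [set b; c] [set b'; c']).
- rewrite -setI_eq0; apply/eqP/setP => x; rewrite !inE.
  by apply/andP => -[/orP[] /eqP -> /orP[] /eqP E]; move: bb' bc' cb' cc'; rewrite E eqxx.
- by rewrite cards2 bc.
- by rewrite cards2 b'c'.
- by rewrite !cards2 bc b'c'.
- by rewrite !inE negb_or rb.
- by rewrite !inE negb_or rb'.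
- by rewrite !inE !negb_or eq_sym ra ab ac ab'.
- by rewrite !inE !negb_or a'a a'r a'b'.
- by move=> x; rewrite !inE => /orP[] /eqP ->.
- by move=> x; rewrite !inE => /orP[] /eqP ->.
- by move=> x; rewrite !inE -!orbA => xN; apply: er; rewrite !inE.
Qed.

End Degrees.

(* [G] minus the three vertices [y, w1, w2] is arbitrary, and these three are
   joined as the path of [B_n], with attachment vertices [u] and [z]. *)
Definition pendant_path (G : sgraph) : Prop :=
  exists u z y w1 w2 : G,
    [/\ uniq [:: u; z; y; w1; w2],
       forall x, edge y x -> x \in [:: u; w1],
       forall x, edge w1 x -> x \in [:: y; w2] &
       forall x, edge w2 x -> x \in [:: w1; z]].

(** * Structure of a 2-connected graph with no HIST and no good weight *)

Section Structure.
Context {G : sgraph} {n : nat}.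
Hypotheses (n8 : 8 <= n) (Gn : #|G| = n) (conn2 : two_connected G) (noHIST : ~ has_HIST G).
(* By [spectral_radius_weight] this holds as soon as the spectral radius
   exceeds [n - 4]: weights [k + 1] on [l] and [k] elsewhere would bound it. *)
Hypothesis no_weight : forall (l : seq G) k, 0 < k ->
  ~ (forall v, k * degree (@edge G) v + count (edge v) l <=
               (n - 4) * (k + (v \in l))).

Lemma large_degree : exists u : G, n - 3 <= degree (@edge G) u.
Proof.
have [/existsP[u] ?|N] := boolP [exists u : G, n - 3 <= degree (@edge G) u].
  by exists u.
case: (no_weight [::] 1) => // v; rewrite mul1n addn0 muln1.
by have := N; rewrite negb_exists => /forallP/(_ v); rewrite -ltnNge; lia.
Qed.

Lemma not_dominating1 (u w : G) : u != w -> ~~ edge u w ->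
  (forall x, x \notin [:: u; w] -> edge u x) -> False.
Proof.
move=> uw Nuw eu.
(* Otherwise [y] could take [w] and [x] as its children. *)
have wN y x : edge w y -> edge y x -> x \in [:: u; w].
  move=> wy yx; apply/negPn/negP => xN; apply: noHIST.
  apply: (@HIST_move2 _ u y w x) => //; first by rewrite Gn; lia.
  - move: xN; rewrite /= !inE !negb_or ![x == _]eq_sym => /andP[-> ->].
    rewrite (edge_neq yx) [y == w]eq_sym (edge_neq wy) uw !andbT.
    by apply: contraNneq Nuw => ->; rewrite edge_sym.
  - by rewrite edge_sym.
  - by move=> z; rewrite !inE !negb_or => /and3P[zu zw _]; apply: eu; rewrite !inE negb_or zu.
(* By [wN], the set of [w] and its neighbours can be left only through [u], so by 2-connectivity it
   contains every other vertex. *)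
have ew z : z \notin [:: u; w] -> edge w z.
  rewrite !inE negb_or => /andP[zu zw].
  apply/negPn/negP => Nwz.
  case: (@two_connected_crossing G u (w |: [set y | edge w y]) w z conn2).
  - by rewrite !inE negb_or uw edge_sym.
  - by rewrite !inE eqxx.
  - by rewrite !inE negb_or zw.
  - by [].
  move=> y [x []]; rewrite !inE negb_or => yX /andP[xw Nwx] xu yx.
  case/orP: yX => [/eqP yw|wy]; first by rewrite -yw yx in Nwx.
  by have := wN y x wy yx; rewrite !inE (negPf xu) (negPf xw).
(* [G] is now complete bipartite with [u], [w] on one side. With weight 2 on these and 1 elsewhere,
   the other vertices require [4 <= n - 4]. *)
apply: (no_weight [:: u; w] 1) => // z; rewrite /= !inE addn0.
have [->|zu] := eqVneq z u.
  rewrite edge_irr (negPf Nuw).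
  have D : degree (@edge G) u + 2 <= n.
    rewrite -Gn; apply: (degree_add_size_le [:: u; w]); rewrite /= ?inE ?uw //.
    by rewrite edge_irr Nuw.
  by lia.
have [->|zw] := eqVneq z w.
  rewrite edge_irr edge_sym (negPf Nuw).
  have D : degree (@edge G) w + 2 <= n.
    rewrite -Gn; apply: (degree_add_size_le [:: u; w]); rewrite /= ?inE ?uw //.
    by rewrite edge_irr edge_sym Nuw.
  by lia.
have wz : edge w z by apply: ew; rewrite !inE negb_or zu.
have := degree_le_size [:: u; w] z (fun x => wN z x wz).
by rewrite /=; lia.
Qed.

Definition codegree2 (u w1 w2 : G) :=
  [/\ uniq [:: u; w1; w2], ~~ edge u w1, ~~ edge u w2 &
      forall x, x \notin [:: u; w1; w2] -> edge u x].

(** * The two non-neighbours [w1] and [w2] of [u] *)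

Section CodegreeTwo.
Context {u w1 w2 : G}.
Hypothesis u_co : codegree2 u w1 w2.

Lemma codegree2C : codegree2 u w2 w1.
Proof.
case: u_co => + Nuw1 Nuw2 eu; rewrite /= !inE negb_or -andbA.
move=> /and4P[uw1 uw2 w12 _]; split => //.
  by rewrite /= !inE negb_or uw1 uw2 eq_sym w12.
by move=> x xN; apply: eu; move: xN; rewrite !inE [_ || (x == w1)]orbC.
Qed.

Lemma inN_attached1 y : edge w1 y -> y != w2 -> y \notin [:: u; w1; w2].
Proof.
case: u_co => _ Nuw1 _ _ w1y yw2; rewrite !inE !negb_or yw2.
rewrite eq_sym [y == w1]eq_sym (edge_neq w1y) /= andbT.
by apply: contraNneq Nuw1 => ->; rewrite edge_sym.
Qed.

(** A common neighbour could take both [w1] and [w2] as its children. *)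
Lemma attached_disjoint y : edge w1 y -> edge w2 y = false.
Proof.
case: u_co => + Nuw1 Nuw2 eu w1y; rewrite /= !inE negb_or -andbA.
move=> /and4P[uw1 uw2 w12 _]; apply/negP => w2y; apply: noHIST.
have uy : u != y by apply: contraNneq Nuw1 => ->; rewrite edge_sym.
apply: (@HIST_move2 _ u y w1 w2); rewrite ?Gn ?[edge y _]edge_sym //; first by lia.
rewrite /= !inE !negb_or uy uw1 uw2 w12 !andbT /=.
by rewrite !(eq_sym y) !edge_neq.
Qed.

(** After deleting [w2], the vertex [w1] must still be joined to the rest. *)
Lemma attached1_exists : exists2 y, edge w1 y & y \notin [:: u; w1; w2].
Proof.
case: u_co => + Nuw1 Nuw2 eu; rewrite /= !inE negb_or -andbA.
move=> /and4P[uw1 uw2 w12 _].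
case: (@two_connected_crossing G w2 [set w1] w1 u conn2);
  rewrite ?inE // 1?eq_sym //.
move=> y [x []]; rewrite !inE => /eqP -> xw1 xw2 w1x.
by exists x => //; exact: inN_attached1.
Qed.

Lemma codegree2_neq : [/\ u != w1, u != w2 & w1 != w2].
Proof.
by case: u_co; rewrite /= !inE negb_or -andbA => /and4P[-> -> -> _].
Qed.

End CodegreeTwo.

Lemma notin3C (u w1 w2 x : G) :
  (x \notin [:: u; w2; w1]) = (x \notin [:: u; w1; w2]).
Proof. by rewrite !inE [_ || (x == w1)]orbC. Qed.

Lemma degree_missed1 u w1 w2 : codegree2 u w1 w2 ->
  degree (@edge G) w1 + 3 <= n.
Proof.
move=> u_co.
have [uw1 uw2 w12] := codegree2_neq u_co.
have [y w2y yN] := attached1_exists (codegree2C u_co).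
have [yu yw2 yw1] : [/\ y != u, y != w2 & y != w1].
  by move: yN; rewrite !inE !negb_or => /and3P[].
have Nw1y := attached_disjoint (codegree2C u_co) _ w2y.
rewrite -Gn; apply: (degree_add_size_le [:: w1; u; y]).
  by rewrite /= !inE !negb_or ![_ == y]eq_sym yw1 yu eq_sym uw1.
by case: u_co => _ Nuw1 _ _; rewrite /= edge_irr edge_sym Nuw1 Nw1y.
Qed.

Lemma degree_missed2 u w1 w2 : codegree2 u w1 w2 -> degree (@edge G) w2 + 3 <= n.
Proof. by move=> /codegree2C; exact: degree_missed1. Qed.

(** * Weights and moves around the neighbourhood of [u] *)

Section Cases.
Context {u w1 w2 : G}.
Hypothesis u_co : codegree2 u w1 w2.

(** By [u_co], these are exactly the neighbours of [u]. *)
Local Notation inN x := (x \notin [:: u; w1; w2]).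
Local Notation attached y := (edge w1 y || edge w2 y).

Lemma inN_neq x : inN x -> [/\ x != u, x != w1 & x != w2].
Proof. by rewrite !inE !negb_or => /and3P[]. Qed.

Lemma degree_center : degree (@edge G) u + 3 <= n.
Proof.
case: u_co => U Nuw1 Nuw2 _.
rewrite -Gn; apply: (degree_add_size_le _ _ U).
by rewrite /= edge_irr Nuw1 Nuw2.
Qed.

(** Five vertices are missed: [z], [w1], [w2], and a neighbour of each of [w1] and [w2], distinct by
    [attached_disjoint]. *)
Lemma degree_far z : inN z -> ~~ attached z ->
  (forall y, inN y -> attached y -> ~~ edge y z) ->
  degree (@edge G) z + 5 <= n.
Proof.
move=> zN; rewrite negb_or => /andP[Nw1z Nw2z] far.
have [uw1 uw2 w12] := codegree2_neq u_co.
have [y1 w1y1 y1N] := attached1_exists u_co.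
have [y2 w2y2] := attached1_exists (codegree2C u_co).
rewrite notin3C => y2N.
have [_ zw1 zw2] := inN_neq _ zN.
have [_ y1w1 y1w2] := inN_neq _ y1N.
have [_ y2w1 y2w2] := inN_neq _ y2N.
have Nw2y1 := attached_disjoint u_co _ w1y1.
have Nzy1 : ~~ edge z y1 by rewrite edge_sym far ?w1y1.
have Nzy2 : ~~ edge z y2 by rewrite edge_sym far ?w2y2 ?orbT.
rewrite -Gn; apply: (degree_add_size_le [:: z; w1; w2; y1; y2]).
  rewrite /= !inE !negb_or zw1 zw2 w12 ![_ == y1]eq_sym ![_ == y2]eq_sym.
  rewrite y1w1 y1w2 y2w1 y2w2 /= !andbT -andbA.
  by apply/and3P; split; [apply: contraNneq Nw1z|apply: contraNneq Nw2z|
     apply: contraFneq Nw2y1] => <-.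
by rewrite /= edge_irr ![edge z w1]edge_sym [edge z w2]edge_sym Nw1z Nw2z Nzy1 Nzy2.
Qed.

Lemma degree_attached (s : seq G) y : inN y -> attached y ->
  (forall x, inN x -> edge y x -> x \in s) ->
  degree (@edge G) y <= (size s).+2.
Proof.
move=> yN yatt ys.
pose w := if edge w1 y then w1 else w2.
apply: (degree_le_size [:: u, w & s]) => x yx; rewrite !inE.
have [xN|] := boolP (inN x); first by rewrite ys ?orbT.
rewrite negbK !inE => /or3P[] /eqP xE; rewrite xE ?eqxx //.
  by rewrite /w edge_sym -xE yx eqxx orbT.
rewrite /w; case: ifP => [w1y|_]; last by rewrite eqxx orbT.
by have := attached_disjoint u_co _ w1y; rewrite -xE edge_sym yx.
Qed.

Lemma count_attached y : edge y w1 + edge y w2 <= 1.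
Proof.
rewrite ![edge y _]edge_sym; have [w1y|_] := boolP (edge w1 y).
  by rewrite (attached_disjoint u_co _ w1y).
by case: (edge w2 y).
Qed.

(** Weight 4 on [u], [w1], [w2] and 3 elsewhere works: attached vertices have degree at most 3, and
    the remaining ones satisfy [degree_far]. *)
Lemma not_sparse :
  (forall y x x', inN y -> attached y -> inN x -> inN x' ->
     edge y x -> edge y x' -> x = x') ->
  (forall y z, inN y -> attached y -> inN z -> ~~ attached z -> ~~ edge y z) ->
  False.
Proof.
move=> attached_nbr far.
have [uw1 uw2 w12] := codegree2_neq u_co.
have [_ Nuw1 Nuw2 _] := u_co.
apply: (no_weight [:: u; w1; w2] 3) => // v; rewrite /= !inE addn0.
have [->|vu] := eqVneq v u.
  by rewrite edge_irr (negPf Nuw1) (negPf Nuw2); have := degree_center; clear -n8; lia.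
have [->|vw1] := eqVneq v w1.
  rewrite edge_irr edge_sym (negPf Nuw1) orbT.
  by have := degree_missed1 _ _ _ u_co; case: (edge w1 w2); clear -n8; lia.
have [->|vw2] := eqVneq v w2.
  rewrite ![edge w2 _]edge_sym edge_irr (negPf Nuw2) !orbT.
  by have := degree_missed2 _ _ _ u_co; case: (edge w1 w2); clear -n8; lia.
have vN : inN v by rewrite !inE !negb_or vu vw1.
rewrite orbF; have [va|Nva] := boolP (attached v).
  have := count_attached v.
  suff : degree (@edge G) v <= 3 by case: (edge v u); clear -n8; lia.
  have [/existsP[x /andP[xN vx]]|Nx] := boolP [exists x, inN x && edge v x].
    by apply: (degree_attached [:: x]) => // x' x'N vx'; rewrite inE (attached_nbr v x' x).
  apply: leqW; apply: (degree_attached [::]) => // x xN vx.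
  by case/existsP: Nx; exists x; rewrite xN.
have := degree_far v vN Nva (fun y yN ya => far y v yN ya vN Nva).
move: Nva; rewrite negb_or ![edge _ v]edge_sym => /andP[/negPf-> /negPf->].
by case: (edge v u); clear -n8; lia.
Qed.

(** Here [x] gets weight 4 too. An attached vertex has at most three neighbours, all possibly heavy,
    which needs [12 <= 3 (n - 4)]. *)
Lemma not_hub x : inN x -> ~~ attached x ->
  (forall y x', inN y -> attached y -> inN x' -> edge y x' -> x' = x) -> False.
Proof.
move=> xN Nxa attached_nbr.
have [uw1 uw2 w12] := codegree2_neq u_co.
have [_ Nuw1 Nuw2 eu] := u_co.
have [xu xw1 xw2] := inN_neq _ xN.
have [Nw1x Nw2x] : edge w1 x = false /\ edge w2 x = false.
  by move: Nxa; rewrite negb_or => /andP[/negPf-> /negPf->].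
apply: (no_weight [:: u; w1; w2; x] 3) => // v; rewrite /= !inE addn0.
have [->|vu] := eqVneq v u.
  rewrite edge_irr (negPf Nuw1) (negPf Nuw2) eu //.
  by have := degree_center; clear -n8; lia.
have [->|vw1] := eqVneq v w1.
  rewrite edge_irr edge_sym (negPf Nuw1) Nw1x orbT.
  by have := degree_missed1 _ _ _ u_co; case: (edge w1 w2); clear -n8; lia.
have [->|vw2] := eqVneq v w2.
  rewrite edge_irr edge_sym (negPf Nuw2) Nw2x !orbT.
  by have := degree_missed2 _ _ _ u_co; case: (edge w2 w1); clear -n8; lia.
have [->|vx] := eqVneq v x.
  rewrite edge_irr [edge x u]edge_sym [edge x w1]edge_sym [edge x w2]edge_sym.
  rewrite Nw1x Nw2x eu //.
  have D : degree (@edge G) x + 3 <= n.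
    rewrite -Gn; apply: (degree_add_size_le [:: x; w1; w2]).
      by rewrite /= !inE negb_or xw1 xw2 w12.
    by rewrite /= edge_irr edge_sym Nw1x edge_sym Nw2x.
  by rewrite !orbT; move: D; clear -n8; lia.
have vN : inN v by rewrite !inE !negb_or vu vw1.
have [va|Nva] := boolP (attached v).
  have := count_attached v.
  suff : degree (@edge G) v <= 3 by case: (edge v u); case: (edge v x); clear -n8; lia.
  apply: (degree_attached [:: x]) => // x' x'N vx'.
  by rewrite inE (attached_nbr v x').
have far y : inN y -> attached y -> ~~ edge y v.
  by move=> yN ya; apply: contra vx => yv; rewrite (attached_nbr y v).
have := degree_far v vN Nva far.
move: Nva; rewrite negb_or ![edge _ v]edge_sym => /andP[/negPf-> /negPf->].
by case: (edge v u); case: (edge v x); clear -n8; lia.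
Qed.

(** Without such a coincidence, [y1] takes [w1] and [x1] as children, and [y2] takes [w2] and
    [x2]. *)
Lemma move_to_both y1 x1 y2 x2 :
  edge w1 y1 -> edge w2 y2 -> edge y1 x1 -> edge y2 x2 ->
  inN y1 -> inN y2 -> inN x1 -> inN x2 ->
  [|| x1 == x2, x1 == y2 | x2 == y1].
Proof.
move=> w1y1 w2y2 y1x1 y2x2 y1N y2N x1N x2N.
have [uw1 uw2 w12] := codegree2_neq u_co.
have [y1u y1w1 y1w2] := inN_neq _ y1N.
have [y2u y2w1 y2w2] := inN_neq _ y2N.
have [x1u x1w1 x1w2] := inN_neq _ x1N.
have [x2u x2w1 x2w2] := inN_neq _ x2N.
apply/negPn/negP; rewrite !negb_or => /and3P[x12 x1y2 x2y1]; apply: noHIST.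
have y12 : y1 != y2.
  by apply/eqP => E; have := attached_disjoint u_co _ w1y1; rewrite E w2y2.
have [y1x1' y2x2'] := (edge_neq y1x1, edge_neq y2x2).
have eu := let: And4 _ _ _ e := u_co in e.
apply: (@HIST_move4 _ u y1 w1 x1 y2 w2 x2); rewrite ?Gn //.
- rewrite /= !inE !negb_or -!andbA; do ?[apply/andP; split] => //;
    by rewrite eq_sym.
- rewrite !inE !negb_or; do ?[apply/andP; split] => //; by rewrite eq_sym.
- by rewrite edge_sym.
- by rewrite edge_sym.
- by move=> v vN; apply: eu; move: vN; rewrite !inE !negb_or => /and5P[-> -> _ -> _].
Qed.

(** Otherwise [y2] takes [w2] and [y1] as children, and [y1] in turn takes [w1] and [x]. *)
Lemma move_chain y1 y2 x : edge w1 y1 -> edge w2 y2 -> edge y1 y2 ->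
  inN y1 -> inN y2 -> inN x -> edge y1 x -> x = y2.
Proof.
move=> w1y1 w2y2 y12 y1N y2N xN y1x; apply/eqP/negPn/negP => xy2.
have [uw1 uw2 w12] := codegree2_neq u_co.
have [y1u y1w1 y1w2] := inN_neq _ y1N.
have [y2u y2w1 y2w2] := inN_neq _ y2N.
have [xu xw1 xw2] := inN_neq _ xN.
have [y12' y1x'] := (edge_neq y12, edge_neq y1x).
have eu := let: And4 _ _ _ e := u_co in e.
apply: noHIST; apply: (@HIST_move4 _ u y2 w2 y1 y1 w1 x); rewrite ?Gn //.
- rewrite /= !inE !negb_or -!andbA; do ?[apply/andP; split] => //;
    by rewrite eq_sym.
- rewrite !inE !negb_or; do ?[apply/andP; split] => //; by rewrite eq_sym.
- by rewrite edge_sym.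
- by rewrite edge_sym.
- by rewrite edge_sym.
- by move=> v vN; apply: eu; move: vN; rewrite !inE !negb_or => /and5P[-> -> _ -> _].
Qed.

(** Otherwise [y] takes [x] and [w2] as children, and [w2] in turn takes [w1] and [y']. *)
Lemma move_through y x y' : edge w1 w2 -> edge w2 y -> edge w2 y' -> edge y x ->
  inN y -> inN y' -> inN x -> y' \in [:: y; x].
Proof.
move=> e12 w2y w2y' yx yN y'N xN; apply/negPn/negP.
rewrite !inE negb_or => /andP[y'y y'x].
have [uw1 uw2 w12] := codegree2_neq u_co.
have [yu yw1 yw2] := inN_neq _ yN.
have [y'u y'w1 y'w2] := inN_neq _ y'N.
have [xu xw1 xw2] := inN_neq _ xN.
have yx' := edge_neq yx.
have eu := let: And4 _ _ _ e := u_co in e.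
apply: noHIST; apply: (@HIST_move4 _ u y x w2 w2 w1 y'); rewrite ?Gn //.
- rewrite /= !inE !negb_or -!andbA; do ?[apply/andP; split] => //;
    by rewrite eq_sym.
- rewrite !inE !negb_or; do ?[apply/andP; split] => //; by rewrite eq_sym.
- by rewrite edge_sym.
- by rewrite edge_sym.
- by move=> v vN; apply: eu; move: vN; rewrite !inE !negb_or => /and5P[-> _ -> -> _].
Qed.

(** The last hypothesis is [move_chain] with [w1] and [w2] exchanged. *)
Lemma not_both_sides y1 x1 y2 x2 :
  edge w1 y1 -> edge w2 y2 -> edge y1 x1 -> edge y2 x2 ->
  inN y1 -> inN y2 -> inN x1 -> inN x2 ->
  (forall y1 y2 x, edge w1 y1 -> edge w2 y2 -> edge y1 y2 ->
     inN y1 -> inN y2 -> inN x -> edge y2 x -> x = y1) -> False.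
Proof.
move=> w1y1 w2y2 y1x1 y2x2 y1N y2N x1N x2N move_chain2.
have disj := attached_disjoint u_co.
have [/existsP[p1 /existsP[p2 /and5P[w1p1 w2p2 p12 p1N p2N]]]|far12] :=
  boolP [exists p1, exists p2, [&& edge w1 p1, edge w2 p2, edge p1 p2, inN p1 & inN p2]].
  have p21 : edge p2 p1 by rewrite edge_sym.
  (* The edge between [p1] and [p2] is the only one inside the neighbourhood of [u] that meets an
     attached vertex, so [not_sparse] applies. *)
  have only1 y x : edge w1 y -> inN y -> inN x -> edge y x -> y = p1 /\ x = p2.
    move=> w1y yN xN yx.
    case/or3P: (move_to_both _ _ _ _ w1y w2p2 yx p21 yN p2N xN p1N) => /eqP E.
    - subst x; have yE := move_chain p1 p2 y w1p1 w2p2 p12 p1N p2N yN.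
      by have := disj _ w1y; rewrite yE ?w2p2 // edge_sym.
    - subst x; split => //; apply: (move_chain2 p1 p2) => //.
      by rewrite edge_sym.
    - by subst y; split=> //; exact: (move_chain p1 p2).
  have only2 y x : edge w2 y -> inN y -> inN x -> edge y x -> y = p2 /\ x = p1.
    move=> w2y yN xN yx.
    case/or3P: (move_to_both _ _ _ _ w1p1 w2y p12 yx p1N yN p2N xN) => /eqP E.
    - subst x; have yE := move_chain2 p1 p2 y w1p1 w2p2 p12 p1N p2N yN.
      by have := disj _ w1p1; rewrite -yE ?w2y // edge_sym.
    - by subst y; split=> //; exact: (move_chain2 p1 p2).
    - subst x; split => //; apply: (move_chain p1 p2) => //.
      by rewrite edge_sym.
  apply: not_sparse => [y x x' yN ya xN x'N yx yx'|y z yN ya zN Nza].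
    by case/orP: ya => wy; [case: (only1 y x) (only1 y x')|case: (only2 y x) (only2 y x')]
       => // _ -> [] // _ ->.
  apply/negP => yz; case/negP: Nza; case/orP: ya => wy.
    by case: (only1 y z) => // _ ->; rewrite w2p2 orbT.
  by case: (only2 y z) => // _ ->; rewrite w1p1.
have Nfar y y' : edge w1 y -> edge w2 y' -> inN y -> inN y' -> edge y y' = false.
  move=> w1y w2y' yN y'N; apply/negP => yy'; case/existsP: far12; exists y.
  by apply/existsP; exists y'; apply/and5P; split.
have Nfar' y y' : edge w1 y -> edge w2 y' -> inN y -> inN y' -> edge y' y = false.
  by rewrite [edge y' y]edge_sym; exact: Nfar.
(* With no edge between the two attached sets, [move_to_both] leaves only the coincidence [x1 = x2],
   and this vertex is a hub. *)
have x12 : x1 = x2.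
  have := move_to_both _ _ _ _ w1y1 w2y2 y1x1 y2x2 y1N y2N x1N x2N.
  case/or3P=> /eqP // E; first by have := Nfar y1 y2 w1y1 w2y2 y1N y2N; rewrite -E y1x1.
  by have := Nfar' y1 y2 w1y1 w2y2 y1N y2N; rewrite -E y2x2.
subst x2; apply: (not_hub x1 x1N).
  apply/negP => /orP[] wx; first by have := Nfar' x1 y2 wx w2y2 x1N y2N; rewrite y2x2.
  by have := Nfar y1 x1 w1y1 wx y1N x1N; rewrite y1x1.
move=> y x yN ya xN yx; case/orP: ya => wy.
  case/or3P: (move_to_both _ _ _ _ wy w2y2 yx y2x2 yN y2N xN x1N) => /eqP // E.
    by have := Nfar y y2 wy w2y2 yN y2N; rewrite -E yx.
  by have := Nfar' y y2 wy w2y2 yN y2N; rewrite -E y2x2.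
case/or3P: (move_to_both _ _ _ _ w1y1 wy y1x1 yx y1N yN x1N xN) => /eqP // E.
  by have := Nfar y1 y w1y1 wy y1N yN; rewrite -E y1x1.
by have := Nfar' y1 y w1y1 wy y1N yN; rewrite -E yx.
Qed.

(** Weight 4 on [u], [w1], [w2], [z] and 3 elsewhere works: [y] and [y'] are missed by [z] and by
    every vertex off [w1], while those attached to [w1] have degree at most 2. *)
Lemma not_one_sided z y y' :
  edge w1 w2 -> edge w2 z -> inN z -> edge w1 y -> inN y -> edge w1 y' -> inN y' ->
  y' != y -> (forall x, inN x -> edge w2 x -> x = z) ->
  (forall y x, inN y -> edge w1 y -> inN x -> ~~ edge y x) -> False.
Proof.
move=> e12 w2z zN w1y yN w1y' y'N y'y only_z iso.
have disj := attached_disjoint u_co.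
have [uw1 uw2 w12] := codegree2_neq u_co.
have [_ Nuw1 Nuw2 eu] := u_co.
have [zu zw1 zw2] := inN_neq _ zN.
have [yu yw1 yw2] := inN_neq _ yN.
have [y'u y'w1 y'w2] := inN_neq _ y'N.
have Nw1z := attached_disjoint (codegree2C u_co) _ w2z.
have Niso q x : inN q -> edge w1 q -> inN x -> edge q x = false.
  by move=> qN w1q xN; apply/negbTE/iso.
have far_deg v : inN v -> edge w1 v = false -> v != y /\ v != y'.
  by move=> vN Nw1v; split; apply: contraFneq Nw1v => ->.
apply: (no_weight [:: u; w1; w2; z] 3) => // v; rewrite /= !inE addn0.
have [->|vu] := eqVneq v u.
  rewrite edge_irr (negPf Nuw1) (negPf Nuw2) eu //.
  by have := degree_center; clear -n8; lia.
have [->|vw1] := eqVneq v w1.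
  rewrite edge_irr edge_sym (negPf Nuw1) Nw1z orbT e12.
  by have := degree_missed1 _ _ _ u_co; clear -n8; lia.
have [->|vw2] := eqVneq v w2.
  rewrite edge_irr edge_sym (negPf Nuw2) !orbT.
  have D : degree (@edge G) w2 <= 2.
    apply: (degree_le_size [:: w1; z]) => x w2x; rewrite !inE.
    have [//|xw1] := eqVneq x w1; apply/eqP/only_z => //.
    by rewrite -notin3C (inN_attached1 (codegree2C u_co)).
  by case: (edge w2 w1); case: (edge w2 z); move: D; clear -n8; lia.
have [->|vz] := eqVneq v z.
  have -> : edge z w1 = false by rewrite edge_sym.
  have D : degree (@edge G) z + 4 <= n.
    have [zy zy'] := far_deg z zN Nw1z.
    rewrite -Gn; apply: (degree_add_size_le [:: z; w1; y; y']).
      rewrite /= !inE !negb_or -!andbA; do ?[apply/andP; split] => //;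
      by rewrite eq_sym.
    rewrite /= edge_irr [edge z w1]edge_sym Nw1z.
    by rewrite [edge z y]edge_sym [edge z y']edge_sym !(Niso _ z).
  rewrite edge_irr !orbT.
  by case: (edge z u); case: (edge z w2); move: D; clear -n8; lia.
have vN : inN v by rewrite !inE !negb_or vu vw1.
have Nw2v : edge w2 v = false.
  by apply/negP => /only_z E; move: vz; rewrite E ?eqxx.
rewrite [edge v w2]edge_sym Nw2v.
have [w1v|/negbTE Nw1v] := boolP (edge w1 v).
  have D : degree (@edge G) v <= 2.
    apply: (degree_attached [::]); rewrite ?w1v // => x xN.
    by rewrite Niso.
  case: (edge v u); case: (edge v w1); case: (edge v z); move: D; clear -n8; lia.
have [vy vy'] := far_deg v vN Nw1v.
have D : degree (@edge G) v + 5 <= n.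
  rewrite -Gn; apply: (degree_add_size_le [:: v; w1; w2; y; y']).
    rewrite /= !inE !negb_or -!andbA; do ?[apply/andP; split] => //;
    by rewrite eq_sym.
  rewrite /= edge_irr [edge v w1]edge_sym [edge v w2]edge_sym Nw1v Nw2v.
  by rewrite [edge v y]edge_sym [edge v y']edge_sym !(Niso _ v).
rewrite [edge v w1]edge_sym Nw1v.
by case: (edge v u); case: (edge v z); move: D; clear -n8; lia.
Qed.

Lemma isolated_side :
  (forall y x, inN y -> edge w1 y -> inN x -> ~~ edge y x) -> pendant_path G.
Proof.
move=> iso.
have disj := attached_disjoint u_co.
have [uw1 uw2 w12] := codegree2_neq u_co.
have [_ Nuw1 Nuw2 eu] := u_co.
have nbr1 y x : inN y -> edge w1 y -> edge y x -> x \in [:: u; w1].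
  move=> yN w1y yx; apply/negPn/negP => xN.
  have xw2 : x != w2.
    by apply/eqP => E; have := disj y w1y; rewrite edge_sym -E yx.
  have := iso y x yN w1y; rewrite yx => /(_ _)/negP; apply => //.
  by move: xN; rewrite !inE !negb_or xw2 andbT.
(* Otherwise deleting [u] would cut off [w1] with its neighbours from [w2]. *)
have e12 : edge w1 w2.
  apply/negPn/negP => N12.
  case: (@two_connected_crossing G u (w1 |: [set y | edge w1 y]) w1 w2 conn2);
    rewrite ?inE ?eqxx ?negb_or ?uw1 //.
  - by rewrite edge_sym.
  - by rewrite eq_sym w12.
  - by rewrite eq_sym.
  move=> y [x []]; rewrite !inE negb_or => yX /andP[xw1 Nw1x] xu yx.
  case/orP: yX => [/eqP yw1|w1y]; first by rewrite -yw1 yx in Nw1x.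
  have yw2 : y != w2 by apply: contraNneq N12 => <-.
  have := nbr1 y x (inN_attached1 u_co _ w1y yw2) w1y yx.
  by rewrite !inE (negPf xu) (negPf xw1).
have [z w2z] := attached1_exists (codegree2C u_co).
rewrite notin3C => zN.
have [/existsP[z' /and3P[w2z' z'N z'z]]|one2] :=
  boolP [exists z', [&& edge w2 z', inN z' & z' != z]].
  (* By [move_through], an edge from [y] to [x] makes these two the only neighbours of [w2] next to
     [u]; this is the situation of [not_sparse]. *)
  have only y x : edge w2 y -> inN y -> inN x -> edge y x ->
      edge w2 x /\ (forall q, edge w2 q -> inN q -> q != y -> q = x).
    move=> w2y yN xN yx.
    have eqx q : edge w2 q -> inN q -> q != y -> q = x.
      move=> w2q qN qy; have := move_through y x q e12 w2y w2q yx yN qN xN.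
      by rewrite !inE (negPf qy) => /eqP.
    split=> //; have [zy|zy] := eqVneq z y; last by rewrite -(eqx z).
    by rewrite -(eqx z') // -zy.
  have iso' y x : edge w1 y -> inN y -> inN x -> edge y x = false.
    by move=> w1y yN xN; apply/negbTE/iso.
  case: not_sparse => [y x x' yN ya xN x'N yx yx'|y q yN ya qN Nqa].
    case/orP: ya => wy; first by rewrite iso' in yx.
    have [w2x _] := only y x wy yN xN yx.
    have [_ eqx'] := only y x' wy yN x'N yx'.
    by apply: eqx' => //; rewrite eq_sym edge_neq.
  apply/negP => yq; case/orP: ya => wy; first by rewrite iso' in yq.
  by case/negP: Nqa; have [->] := only y q wy yN qN yq; rewrite orbT.
have only_z x : inN x -> edge w2 x -> x = z.
  move=> xN w2x; apply/eqP/negPn/negP => xz; case/existsP: one2; exists x.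
  by rewrite w2x xN.
have [y w1y yN] := attached1_exists u_co.
have [/existsP[y' /and3P[w1y' y'N y'y]]|one1] :=
  boolP [exists y', [&& edge w1 y', inN y' & y' != y]].
  by case: (not_one_sided z y y').
have [zu zw1 zw2] := inN_neq _ zN.
have [yu yw1 yw2] := inN_neq _ yN.
have zy : z != y by apply/eqP => E; have := disj y w1y; rewrite -E w2z.
exists u, z, y, w1, w2; split.
- rewrite /= !inE !negb_or -!andbA; do ?[apply/andP; split] => //;
    by rewrite eq_sym.
- by move=> x; exact: nbr1.
- move=> x w1x; rewrite !inE; have [//|xw2] := eqVneq x w2; rewrite ?orbT // orbF.
  apply/negPn/negP => xy; case/existsP: one1; exists x.
  by rewrite w1x xy (inN_attached1 u_co).
- move=> x w2x; rewrite !inE; have [//|xw1] := eqVneq x w1.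
  by apply/eqP/only_z => //; rewrite -notin3C (inN_attached1 (codegree2C u_co)).
Qed.

End Cases.

(** * Case distinctions leading to the pendant path *)

Lemma pendant_path_codegree2 u w1 w2 : codegree2 u w1 w2 -> pendant_path G.
Proof.
move=> u_co.
(* A neighbour [y] of [w] with an edge inside the neighbourhood of [u]. If one of [w1], [w2] has
   none, [isolated_side] applies; otherwise [not_both_sides] does. *)
pose active w y x := [&& edge w y, y \notin [:: u; w1; w2], x \notin [:: u; w1; w2] & edge y x].
have [/existsP[y1 /existsP[x1 /and4P[w1y1 y1N x1N y1x1]]]|N1] :=
  boolP [exists y, exists x, active w1 y x]; last first.
  apply: (isolated_side u_co) => y x yN w1y xN; apply: contra N1 => yx.
  by apply/existsP; exists y; apply/existsP; exists x; apply/and4P; split.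
have [/existsP[y2 /existsP[x2 /and4P[w2y2 y2N x2N y2x2]]]|N2] :=
  boolP [exists y, exists x, active w2 y x]; last first.
  apply: (isolated_side (codegree2C u_co)) => y x; rewrite !(notin3C u w1 w2) => yN w2y xN.
  apply: contra N2 => yx.
  by apply/existsP; exists y; apply/existsP; exists x; apply/and4P; split.
have chain2 p1 p2 x : edge w1 p1 -> edge w2 p2 -> edge p1 p2 ->
    p1 \notin [:: u; w1; w2] -> p2 \notin [:: u; w1; w2] ->
    x \notin [:: u; w1; w2] -> edge p2 x -> x = p1.
  rewrite [edge p1 p2]edge_sym => w1p1 w2p2 p21; rewrite -!(notin3C u w1 w2) => p1N p2N xN.
  exact: (move_chain (codegree2C u_co) p2 p1 x).
by case: (not_both_sides u_co y1 x1 y2 x2).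
Qed.

Lemma no_HIST_pendant_path : pendant_path G.
Proof.
have [u deg_u] := large_degree.
pose W := [set x | (x != u) && ~~ edge u x].
have W_nbr x : x != u -> x \notin W -> edge u x.
  by move=> xu; rewrite inE xu negbK.
have cardW : #|W| <= 2.
  have := degree_add_size_le (u :: enum W) u; rewrite Gn /= -cardE => D.
  suff : degree (@edge G) u + #|W|.+1 <= n by move: deg_u; clear -n8; lia.
  apply: D; first by rewrite mem_enum enum_uniq inE eqxx.
  rewrite edge_irr; apply/allP => x; rewrite mem_enum inE => /andP[_ Nux].
  exact: Nux.
case: (ltngtP #|W| 1) cardW => [W0 _|W2 W2'|/eqP/cards1P[w WE] _].
- have {}W0 : W = set0 by apply/eqP; rewrite -cards_eq0; move: W0; clear; lia.
  have /card_gt0P[a aN] : 0 < #|~: [set u]| by rewrite cardsC1 Gn; clear -n8; lia.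
  have /card_gt0P[b bN] : 0 < #|~: [set u; a]|.
    have := cardsC [set u; a]; rewrite Gn cards2; case: (u != a); clear -n8; lia.
  (* The spanning star at [u] is a HIST; [a] and [b] are dummy parents. *)
  case: noHIST; apply: (@HIST_two_moves G u a b set0 set0).
  + by rewrite -setI_eq0 setI0.
  + by rewrite cards0.
  + by rewrite cards0.
  + by rewrite cards0 Gn; clear -n8; lia.
  + by rewrite inE.
  + by rewrite inE.
  + by move: aN; rewrite !inE !orbF.
  + by move: bN; rewrite !inE orbF orbC.
  + by move=> x; rewrite inE.
  + by move=> x; rewrite inE.
  by move=> x; rewrite !inE !orbF => xu; apply: W_nbr; rewrite ?W0 ?inE.
- have /cards2P[w1 [w2 [w12 WE]]] : #|W| == 2 by rewrite eqn_leq W2'.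
  have : w1 \in W by rewrite WE !inE eqxx.
  have : w2 \in W by rewrite WE !inE eqxx orbT.
  rewrite !inE => /andP[w2u Nuw2] /andP[w1u Nuw1].
  apply: (@pendant_path_codegree2 u w1 w2); split => //.
    by rewrite /= !inE negb_or ![u == _]eq_sym w1u w2u w12.
  by move=> x; rewrite !inE negb_or => /andP[xu xw]; apply: W_nbr; rewrite // WE !inE.
have : w \in W by rewrite WE inE.
rewrite inE => /andP[wu Nuw]; case: (not_dominating1 u w) => //.
  by rewrite eq_sym.
by move=> x; rewrite !inE negb_or => /andP[xu xw]; apply: W_nbr; rewrite // WE !inE.
Qed.

End Structure.

(** * Identification of a graph without a HIST with the extremal graph *)

Theorem theorem1p2 (R : realType) (n : nat) (hn : 8 <= n) (G : sgraph)
    (hG : #|G| = n) (h2 : two_connected G)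
    (hrho : (spectral_radius R (B_graph n) <= spectral_radius R G)%R) :
  ~ isomorphic G (B_graph n) -> has_HIST G.
Proof.
have [//|noHIST not_iso] := boolp.EM (has_HIST G); case: not_iso.
have [_ connG _] := h2.
have rho_gt := lt_le_trans (B_graph_spectral_radius_gt R n hn) hrho.
have no_weight (l : seq G) k : 0 < k ->
    ~ (forall v, k * degree (@edge G) v + count (edge v) l <=
                 (n - 4) * (k + (v \in l))).
  move=> k0 weight_l; move: rho_gt; apply/negP; rewrite -leNgt.
  by apply: (spectral_radius_weight connG l k) => //; rewrite hG; lia.
have [u [z [y [w1 [w2 [U Ny Nw1 Nw2]]]]]] := no_HIST_pendant_path hn hG h2 noHIST no_weight.
have := B_graph_embedding G u z y w1 w2 U Ny Nw1 Nw2; rewrite hG.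
by case=> f f_inj f_edge; exact: (isomorphic_B_graph R n G f).
Qed.
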